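(* For every integer $n>0$ and every measurable function $g:[0,1]^n\to\mathbb{R}$, there is a measurable set $F\subset[0,1]^n$ such that $\lambda(F)=1$ and $g(F)$ contains no interval.
   Context: $\lambda$ denotes $n$-dimensional Lebesgue measure. ''Interval'' means a non-degenerate interval of $\mathbb{R}$ (one containing more than one point). *)

(* Defs.v *)
From HB Require Import structures.
From mathcomp Require Import all_boot all_order all_algebra.
From mathcomp Require Import all_classical all_reals all_analysis.

Set Implicit Arguments.
Unset Strict Implicit.
Unset Printing Implicit Defensive.

Import Order.TTheory GRing.Theory Num.Theory.
Import numFieldNormedType.Exports.

Local Open Scope classical_set_scope.
Local Open Scope ring_scope.

Section cons_tuple.
Context {R : realType}.
Local Notation RR := (measurableTypeR R).

Definition tcons n (p : RR * n.-tuple RR) : n.+1.-tuple RR :=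
  [tuple of p.1 :: p.2].

Lemma measurable_tcons n : measurable_fun setT (@tcons n).
Proof. exact: measurable_cons. Qed.

Definition tuncons n (x : n.+1.-tuple RR) : RR * n.-tuple RR :=
  (thead x, [tuple of behead x]).

Lemma tconsK n : cancel (@tcons n) (@tuncons n).
Proof. by move=> [a t]; rewrite /tuncons/=; congr pair; exact: val_inj. Qed.

Lemma measurable_tuncons n : measurable_fun setT (@tuncons n).
Proof.
apply/measurable_fun_pair; first exact: measurable_tnth.
exact: measurable_behead.
Qed.

End cons_tuple.

(* The n-fold product of one-dimensional Lebesgue measure, meaningful on the
   Borel sets of R^n; borel_lebesgue_box below gives its value on boxes. *)
Fixpoint borel_lebesgue (R : realType) (n : nat) :
    set (n.-tuple (measurableTypeR R)) -> \bar R :=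
  match n with
  | 0 => dirac [tuple]
  | k.+1 => pushforward (@lebesgue_measure R \x @borel_lebesgue R k)%E
              (@tcons R k)
  end.

Section pushforward_tcons.
Context (R : realType) (n : nat).
Local Notation RR := (measurableTypeR R).
Local Open Scope ereal_scope.
Variable m : {sigma_finite_measure set (n.-tuple RR) -> \bar R}.

Let nu : set (n.+1.-tuple RR) -> \bar R :=
  pushforward (@lebesgue_measure R \x m) (@tcons R n).

Let mcons (A : set (n.+1.-tuple RR)) :
  measurable A -> measurable (@tcons R n @^-1` A).
Proof.
by move=> mA; rewrite -[X in measurable X]setTI; exact: measurable_tcons.
Qed.

Let nu0 : nu set0 = 0.
Proof. by rewrite /nu /pushforward preimage_set0 measure0. Qed.

Let nu_ge0 A : 0 <= nu A.
Proof. exact: (measure_ge0 (@lebesgue_measure R \x m)). Qed.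

Let nu_sigma_additive : semi_sigma_additive nu.
Proof.
move=> F mF tF mUF; rewrite /nu /pushforward preimage_bigcup.
apply: measure_semi_sigma_additive.
- by move=> i; exact: mcons.
- apply/trivIsetP => /= i j _ _ ij; rewrite -preimage_setI.
  by move/trivIsetP : tF => /(_ _ _ _ _ ij) ->//; rewrite preimage_set0.
- by rewrite -preimage_bigcup; exact: mcons.
Qed.

HB.instance Definition _ := isMeasure.Build _ _ _ nu
  nu0 nu_ge0 nu_sigma_additive.

(* The sigma-finite instance on products in the library is hidden by the one on
   products of probabilities, hence the explicit cover. *)
Let nu_sigma_finite : sigma_finite setT nu.
Proof.
have /sigma_finiteP[F [TF ndF Foo]] := sigma_finiteT (@lebesgue_measure R).
have /sigma_finiteP[G [TG ndG Goo]] := sigma_finiteT m.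
exists (fun k => @tuncons R n @^-1` (F k `*` G k)).
  rewrite -preimage_bigcup; apply/seteqP; split => // x _ /=.
  have [i _ Fi] : (\bigcup_k F k) (tuncons x).1 by rewrite -TF.
  have [j _ Gj] : (\bigcup_k G k) (tuncons x).2 by rewrite -TG.
  exists (maxn i j) => //; split.
    by move: Fi; exact/subsetPset/ndF/leq_maxl.
  by move: Gj; exact/subsetPset/ndG/leq_maxr.
move=> k; have [mF Fk] := Foo k; have [mG Gk] := Goo k; split.
  rewrite -[X in measurable X]setTI; apply: measurable_tuncons => //.
  exact: measurableX.
rewrite /nu /pushforward -comp_preimage (_ : _ \o _ = id); last first.
  by apply/funext => x; exact: tconsK.
by rewrite preimage_id product_measure1E// lte_mul_pinfty// ge0_fin_numE.
Qed.

HB.instance Definition _ := Measure_isSigmaFinite.Build _ _ _ nu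
  nu_sigma_finite.

Lemma pushforward_tcons_sigma_finite_measure :
  exists m' : {sigma_finite_measure set (n.+1.-tuple RR) -> \bar R},
    nu = m' :> (set _ -> \bar R).
Proof. by exists nu. Qed.

End pushforward_tcons.

Section borel_lebesgue_measure.
Context (R : realType).
Local Notation RR := (measurableTypeR R).
Local Open Scope ereal_scope.

Let exists_measure n :
  exists m : {sigma_finite_measure set (n.-tuple RR) -> \bar R},
    @borel_lebesgue R n = m :> (set _ -> \bar R).
Proof.
elim: n => [|n [m mE]].
  by exists (dirac ([tuple] : 0.-tuple RR)).
by rewrite /= mE; exact: pushforward_tcons_sigma_finite_measure.
Qed.

Let borel_lebesgue0 n : @borel_lebesgue R n set0 = 0.
Proof. by have [m ->] := exists_measure n; exact: measure0. Qed.

Let borel_lebesgue_ge0 n A : 0 <= @borel_lebesgue R n A.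
Proof. by have [m ->] := exists_measure n; exact: measure_ge0. Qed.

Let borel_lebesgue_sigma_additive n : semi_sigma_additive (@borel_lebesgue R n).
Proof.
by have [m ->] := exists_measure n; exact: measure_semi_sigma_additive.
Qed.

HB.instance Definition _ n := isMeasure.Build _ _ _ (@borel_lebesgue R n)
  (borel_lebesgue0 n) (@borel_lebesgue_ge0 n)
  (@borel_lebesgue_sigma_additive n).

Let borel_lebesgue_sigma_finite n : sigma_finite setT (@borel_lebesgue R n).
Proof. by have [m ->] := exists_measure n; exact: sigma_finiteT. Qed.

HB.instance Definition _ n := Measure_isSigmaFinite.Build _ _ _
  (@borel_lebesgue R n) (borel_lebesgue_sigma_finite n).

Lemma borel_lebesgue_box n (A : 'I_n -> set RR) :
  (forall i, measurable (A i)) ->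
  borel_lebesgue [set x : n.-tuple RR | forall i, A i (tnth x i)] =
  \prod_(i < n) lebesgue_measure (A i).
Proof.
elim: n A => [|n ih] A mA.
  by rewrite big_ord0 /= diracE mem_set//= => -[].
rewrite big_ord_recl -ih => [|i]; last exact: mA.
rewrite -[LHS]/((lebesgue_measure \x @borel_lebesgue R n) _).
rewrite -product_measure1E//; last first.
  rewrite (_ : [set x | _] = \bigcap_(i in [set: 'I_n])
      ((@tnth n RR)^~ i @^-1` A (lift ord0 i))); last first.
    by apply/seteqP; split => x /= H i; [move=> _|]; exact: H.
  apply: fin_bigcap_measurable => // i _.
  by rewrite -[X in measurable X]setTI; exact: measurable_tnth.
congr ((_ \x _) _); apply/seteqP; split => -[a t] /=.
- move=> H; split; first exact: (H ord0).
  by move=> i; have := H (lift ord0 i); rewrite tnthS.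
- move=> [Ha Ht] i; case: (unliftP ord0 i) => [j ->|->]; last exact: Ha.
  by rewrite tnthS.
Qed.

End borel_lebesgue_measure.

Section lebesgue_space.
Context (R : realType) (n : nat).

(* R^n with the sigma-algebra of Lebesgue measurable sets: those that are
   Caratheodory measurable for Lebesgue outer measure, not only Borel ones *)
Definition lebesgue_space :=
  caratheodory_type ((@borel_lebesgue R n)^*)%mu.
HB.instance Definition _ := Measurable.on lebesgue_space.

Definition lebesgue_measure_n : set lebesgue_space -> \bar R :=
  @completed_measure_extension _ _ _ (@borel_lebesgue R n).
HB.instance Definition _ := Measure.on lebesgue_measure_n.

Definition unit_cube : set lebesgue_space :=
  [set x | forall i : 'I_n, (0 <= tnth x i <= 1)%R].

End lebesgue_space.

Section lebesgue_measure_n_box.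
Context (R : realType) (n : nat).
Local Notation RR := (measurableTypeR R).
Local Open Scope ereal_scope.

Lemma lebesgue_measure_n_borel (A : set (n.-tuple RR)) : measurable A ->
  measurable (A : set (lebesgue_space R n)) /\
  lebesgue_measure_n (A : set (lebesgue_space R n)) = borel_lebesgue A.
Proof.
move=> mA; split; last exact: measurable_mu_extE.
exact: caratheodory_measurable_mu_ext.
Qed.

Lemma lebesgue_measure_n_box (A : 'I_n -> set RR) :
  (forall i, measurable (A i)) ->
  let B : set (lebesgue_space R n) := [set x | forall i, A i (tnth x i)] in
  measurable B /\ lebesgue_measure_n B = \prod_(i < n) lebesgue_measure (A i).
Proof.
move=> mA B.
have mB : measurable (B : set (n.-tuple RR)).
  rewrite (_ : B = \bigcap_(i in [set: 'I_n])
      ((@tnth n RR)^~ i @^-1` A i)); last first.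
    by apply/seteqP; split => x /= H i; [move=> _|]; exact: H.
  apply: fin_bigcap_measurable => // i _.
  by rewrite -[X in measurable X]setTI; exact: measurable_tnth.
by have [? ->] := lebesgue_measure_n_borel mB; split => //;
  exact: borel_lebesgue_box.
Qed.

Lemma measurable_unit_cube : measurable (@unit_cube R n).
Proof. exact: (lebesgue_measure_n_box (fun=> measurable_itv `[0%R, 1%R])).1. Qed.

Lemma lebesgue_measure_n_unit_cube : lebesgue_measure_n (@unit_cube R n) = 1.
Proof.
rewrite (lebesgue_measure_n_box (fun=> measurable_itv `[0%R, 1%R])).2.
by rewrite big1// => i _; rewrite lebesgue_measure_itv/= lte_fin ltr01 oppr0 adde0.
Qed.

End lebesgue_measure_n_box.

Definition nondegenerate_interval (R : realType) (I : set R) :=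
  is_interval I /\ exists x y, [/\ I x, I y & x != y].

(* Main.v *)
Require Import Defs.
From mathcomp Require Import all_boot all_order all_algebra.
From mathcomp Require Import all_classical all_reals all_analysis.

Set Implicit Arguments.
Unset Strict Implicit.
Unset Printing Implicit Defensive.

Import Order.TTheory GRing.Theory Num.Theory.
Import numFieldNormedType.Exports.

Local Open Scope classical_set_scope.

(* Only countably many values y have a level set g^-1(y) of positive measure,
   so there is a dense sequence of values whose level sets are null. Removing
   these level sets from the cube costs no measure, and the image of what is
   left misses a dense set, hence contains no interval. *)

(** Restricted to [D] and normalised, [mu] becomes a probability for which [g] is a random variable,
    and a random variable has only countably many atoms. *)
Lemma countable_level_set_gt0 d (T : measurableType d) (R : realType)
    (mu : {measure set T -> \bar R}%R) (D : set T) (g : T -> R) :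
    measurable D -> (mu D < +oo)%E -> measurable_fun D g ->
  countable [set y | (0 < mu (D `&` g @^-1` [set y]))%E].
Proof.
move=> mD Doo mg.
have mgD y : measurable (D `&` g @^-1` [set y]) by exact: mg.
(* Mass 0 cannot be normalised, but then no level set in [D] has positive measure. *)
have [D0|Dn0] := eqVneq (mu D) 0%E.
  rewrite (_ : [set y | _] = set0); first exact: countable0.
  apply/seteqP; split => // y /=.
  rewrite ltNge => /negP; apply; rewrite -D0.
  by apply: le_measure; rewrite ?inE//; exact: subIsetl.
(* [mnormalize] asks for a fallback probability; a point of [D] supplies a Dirac one. *)
have [x0 _] : D !=set0.
  by apply/set0P/eqP => D_eq0; rewrite D_eq0 measure0 eqxx in Dn0.
pose nu : {measure set T -> \bar R}%R := mrestr mu mD.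
have nuT : nu setT = mu D by rewrite /nu/= /mrestr setTI.
pose P : probability T R := mnormalize nu (dirac x0).
have mX : measurable_fun setT (g \_ D) by move/(measurable_restrictT g mD): mg.
pose X : {RV P >-> R} := mfun_Sub (mem_set mX).
apply: sub_countable (pmf_gt0_countable X); apply: subset_card_le => y /= y0.
(* Outside [D], [X] takes a default value, which may be [y]; intersecting with [D], as [nu] does,
   discards those points. *)
have XE : (X @^-1` [set y]) `&` D = D `&` g @^-1` [set y].
  apply/seteqP; split => x /=; first by rewrite patchE => -[+ Dx]; rewrite mem_set.
  by move=> [Dx gx]; rewrite patchE mem_set.
have PE : P (X @^-1` [set y]) =
    (mu (D `&` g @^-1` [set y]) * (fine (mu D))^-1%:E)%E.
  by rewrite /P/= /mnormalize nuT (negbTE Dn0) (lt_eqF Doo)/= -XE.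
apply: fine_gt0; rewrite PE; apply/andP; split.
  rewrite mule_gt0// lte_fin invr_gt0; apply: fine_gt0.
  by rewrite Doo lt0e Dn0 measure_ge0.
rewrite -PE; exact: le_lt_trans (probability_le1 P _) (ltry _).
Qed.

(** A nonempty open interval has positive length, so a countable [C] cannot cover it. One point
    outside [C] is chosen for each pair of rational endpoints, and the pairs are enumerated. *)
Lemma dense_seq_setC_countable (R : realType) (C : set R) : countable C ->
  exists s : nat -> R, (forall n, ~ C (s n)) /\
    forall x y : R, (x < y)%R -> exists n, (x < s n < y)%R.
Proof.
move=> cC.
have exC (x y : R) : (x < y)%R -> exists2 z, ~ C z & (x < z < y)%R.
  move=> xy; apply: contrapT => /forall2NP noz.
  have : countable `]x, y[%classic.
    apply: sub_countable cC; apply: subset_card_le => z /=.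
    by rewrite in_itv/= => zxy; have [/contrapT|] := noz z.
  move/countable_lebesgue_measure0 => /eqP.
  by rewrite lebesgue_measure_itv/= lte_fin xy -EFinD eqe subr_eq0 gt_eqF.
(* Pairs in the wrong order also receive a point outside [C], so every term of the sequence avoids
   [C], including those at codes of no pair, sent to [(0, 0)]. *)
have /choice[f fP] (p : rat * rat) : exists z : R,
    ~ C z /\ ((p.1 < p.2)%R -> (ratr p.1 < z < ratr p.2)%R).
  have [p12|p12] := ltP p.1 p.2.
    by have [|z] := exC (ratr p.1) (ratr p.2); [rewrite ltr_rat | exists z].
  by have [z] := exC _ _ (@ltr01 R); exists z.
exists (fun n => f (odflt (0, 0)%R (unpickle n))); split=> [n|x y xy].
  by have [] := fP (odflt (0, 0)%R (unpickle n)).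
have [p /[!in_itv]/= /andP[xp py]] := rat_in_itvoo xy.
have [q /[!in_itv]/= /andP[pq qy]] := rat_in_itvoo py.
exists (pickle (p, q)); rewrite pickleK/=.
have [_ /= /(_ _)/andP[|pf fq]] := fP (p, q); first by rewrite -(ltr_rat R).
by rewrite (lt_trans xp pf) (lt_trans fq qy).
Qed.

Theorem mainTheorem3 (R : realType) (n : nat) (n_gt0 : (0 < n)%N)
    (g : lebesgue_space R n -> R) (mg : measurable_fun (@unit_cube R n) g) :
  exists F : set (lebesgue_space R n),
    [/\ measurable F, F `<=` @unit_cube R n, lebesgue_measure_n F = 1%E &
        forall I : set R, nondegenerate_interval I -> ~ (I `<=` g @` F)].
Proof.
have mQ := @measurable_unit_cube R n.
have Q1 := @lebesgue_measure_n_unit_cube R n.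
have [|s [sC sd]] := dense_seq_setC_countable
  (countable_level_set_gt0 (mu := @lebesgue_measure_n R n) mQ _ mg).
  by rewrite [ltLHS]Q1 ltry.
pose N := \bigcup_k (@unit_cube R n `&` g @^-1` [set s k]).
have mNk k : measurable (@unit_cube R n `&` g @^-1` [set s k]) by exact: mg.
have mN : measurable N by exact: bigcupT_measurable.
have N0 : lebesgue_measure_n N = 0%E.
  apply/measure_negligible => //; apply: negligible_bigcup => k.
  (* Since [s k] avoids the exceptional values, its level set does not have positive measure. *)
  apply/negligibleP => //; apply/eqP; rewrite -measure_le0 leNgt.
  by apply/negP; exact: sC.
exists (@unit_cube R n `\` N); split.
- exact: measurableD.
- exact: subDsetl.
- have NQ : N `<=` @unit_cube R n by apply: bigcup_sub => k _; exact: subIsetl.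
  rewrite measureD//=; last by rewrite [ltLHS]Q1 ltry.
  rewrite (setIidr NQ).
  by rewrite [X in (X - _)%E]Q1 [X in (_ - X)%E]N0 sube0.
- move=> I [itvI [x [y [Ix Iy xy]]]] Ig.
  wlog {xy} xy : x y Ix Iy / (x < y)%R.
    by move=> H; case: ltgtP xy => // [xy|yx] _; [exact: (H x y)|exact: (H y x)].
  (* Some [s k] lies between [x] and [y], hence in [I]; a preimage of it in the cube would belong to
     the removed set [N]. *)
  have [k /andP[xs sy]] := sd _ _ xy.
  have [|z [Qz Nz] gz] := Ig (s k).
    apply: (itvI x y) => //; by rewrite (ltW xs) (ltW sy).
  by apply: Nz; exists k.
Qed.
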